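(* The number $R_3(L)$ satisfies $R_3(L) \leq 493$.
   Context: For a positive integer $n$, the $n \times n$ integer grid is $[n]\times[n]=\{(i,j): 1\le i,j\le n\}$, where $(i,j)$ is the point in row $i$ (rows counted downward) and column $j$ (columns counted left to right). Given a coloring of $[n]\times[n]$ with $k$ colors (an arbitrary map from $[n]\times[n]$ to a set of $k$ colors), a monochromatic $L$ is a set of three points $\{(x,y),(x+d,y),(x+d,y+d)\}\subseteq [n]\times[n]$, with $d$ a positive integer, all having the same color. For a positive integer $k$, $R_k(L)$ denotes the least positive integer $n$ such that every $k$-coloring of $[n]\times[n]$ contains a monochromatic $L$ (it exists by the Gallai-Witt theorem). *)

(* Defs.v *)
From mathcomp Require Import all_boot.

Set Implicit Arguments.
Unset Strict Implicit.
Unset Printing Implicit Defensive.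

(* The grid [n] x [n] is indexed from 0: the pair (i, j) : 'I_n * 'I_n stands
   for the point in row i + 1 and column j + 1. *)
Definition coloring (k n : nat) : Type := 'I_n * 'I_n -> 'I_k.

(* The three points are (x, y), (x', y) and (x', y'), with x' = x + d and
   y' = y + d; typing x' and y' in 'I_n keeps all of them in the grid. *)
Definition has_mono_L (k n : nat) (c : coloring k n) : Prop :=
  exists (x y x' y' : 'I_n) (d : nat),
    [/\ 0 < d, x' = x + d :> nat & y' = y + d :> nat] /\
    (c (x, y) = c (x', y) /\ c (x', y) = c (x', y')).

Definition L_unavoidable (k n : nat) : Prop :=
  forall c : coloring k n, has_mono_L c.

(* R_k(L) = r, i.e. r is the least positive n with L_unavoidable k n.  This is
   a relation, functional in k, so that its definition does not rest on the
   existence of such an n. *)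
Definition is_RL (k r : nat) : Prop :=
  [/\ 0 < r, L_unavoidable k r
    & forall m : nat, 0 < m -> L_unavoidable k m -> r <= m].

(* Main.v *)
Require Import Defs.
From mathcomp Require Import all_boot.
From mathcomp Require Import zify.
From Stdlib Require Import PeanoNat NArith Classical Wf_nat.

Set Implicit Arguments.
Unset Strict Implicit.
Unset Printing Implicit Defensive.

(** Let [f] colour the main diagonal and suppose that there is no monochromatic
    L.  For colours [g <> h] and [D > 0] let [S(g, h, D)] be the set of [a] such
    that [f a = f (a + D) = g] and the point [(a + D, a)], which cannot have
    colour [g], has colour [h].  Every positive difference occurs at most once
    in [S(g, h, D)], so these sets are Sidon sets.  On the other hand a third of
    the pairs on the diagonal have equal colours, so the six sets belonging to a
    small [D] have about [n / 3] elements altogether: too many for Sidon sets.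
    To make this quantitative up to [n = 493], the pairs of elements of the
    [S(g, h, D)] inside a window of length [l] are counted with weight [w - D],
    over all windows of the diagonal, also those sticking out of it.  The Sidon
    property bounds the total from above.  From below, the count in each window
    is estimated by convexity from the weighted number of equally coloured
    pairs, which in turn is estimated by convexity over the windows of length
    [w].  The two bounds contradict each other for [l = 198] and [w = 66]. *)

(** * Convexity and counts over windows *)

(* Convexity of ['C(m, 2)] in tangent form, with slope [q]. *)
Lemma bin2_tangent (q m : nat) : q * m <= 'C(m, 2) + 'C(q.+1, 2).
Proof.
elim: m q => [|m IHm] [|q]; rewrite ?muln0 ?mul0n //.
by have := IHm q; rewrite (binS m) (binS q.+1) !bin1; lia.
Qed.

Lemma sum_bin2_tangent (I : finType) (P : pred I) (m : I -> nat) (q : nat) :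
  q * (\sum_(j | P j) m j) <= \sum_(j | P j) 'C(m j, 2) + #|P| * 'C(q.+1, 2).
Proof.
rewrite big_distrr /= -sum_nat_const -big_split /=.
by apply: leq_sum => j _; apply: bin2_tangent.
Qed.

Lemma sum_range (n lo hi : nat) :
  \sum_(a < n) (lo <= a < hi) = minn hi n - lo.
Proof.
elim: n => [|n IHn]; first by rewrite big_ord0; lia.
by rewrite big_ord_recr /= IHn; lia.
Qed.

Lemma sum_subn_leq (n m : nat) : \sum_(i < n) (m - i.+1) <= 'C(m, 2).
Proof.
elim: n m => [|n IHn] m; first by rewrite big_ord0.
case: m => [|m]; first by rewrite big1.
rewrite big_ord_recl binS bin1 subn1 addnC leq_add2r /=.
by under eq_bigr => i _ do rewrite /bump subSS.
Qed.

(** Pairs are grouped by difference [i.+1] and smaller element [a]; in the induction the new point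
    [n] pairs with every earlier [a]. *)
Lemma bin2_sum_pairs (n : nat) (Q : nat -> bool) :
  'C(\sum_(a < n) Q a, 2) =
  \sum_(i < n) \sum_(a < n) [&& a + i.+1 < n, Q a & Q (a + i.+1)].
Proof.
elim: n => [|n IHn]; first by rewrite !big_ord0.
have binD (m : nat) (b : bool) : 'C(m + b, 2) = 'C(m, 2) + b * m.
  by case: b; rewrite ?addn0 // addn1 binS bin1 mul1n.
rewrite big_ord_recr /= binD {}IHn [RHS]big_ord_recr /=.
rewrite [X in _ = _ + X]big1 ?addn0; last first.
  by move=> a _; rewrite ltnNge (_ : n.+1 <= a + n.+1) //; lia.
(* The interval condition means [a + i.+1 = n]; in this form [sum_range] evaluates its sum over
   [i]. *)
have split_last (i : 'I_n) :
    \sum_(a < n.+1) [&& a + i.+1 < n.+1, Q a & Q (a + i.+1)] =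
    \sum_(a < n) [&& a + i.+1 < n, Q a & Q (a + i.+1)]
    + \sum_(a < n) (n - a.+1 <= i < n - a) * (Q n && Q a).
  rewrite big_ord_recr /= [X in _ + X](_ : _ = 0) ?addn0; last first.
    by rewrite ltnNge (_ : n.+1 <= n + i.+1) //; lia.
  rewrite -big_split; apply: eq_bigr => a _ /=; have [lt_i lt_a] := (ltn_ord i, ltn_ord a).
  have [eq_n | neq_n] := eqVneq (a + i.+1) n.
    rewrite eq_n ltnn ltnSn (_ : n - a.+1 <= i < n - a = true); last by lia.
    by rewrite /= add0n mul1n andbC.
  rewrite (_ : n - a.+1 <= i < n - a = false); last by lia.
  by rewrite (_ : (a + i.+1 < n.+1) = (a + i.+1 < n)) ?addn0 //; lia.
rewrite (eq_bigr _ (fun i _ => split_last i)) big_split /=; congr (_ + _).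
rewrite exchange_big big_distrr; apply: eq_bigr => a _ /=.
rewrite -big_distrl sum_range /=; have := ltn_ord a.
by case: (Q n); case: (Q a) => //=; lia.
Qed.

(** A pair [a], [a + i.+1] is counted only for [t] with [a + i.+1 + D <= t < a + l]. *)
Lemma sum_bin2_windows (n l D R : nat) (Q : nat -> bool) :
  \sum_(t < R) 'C(\sum_(a < n) (Q a && (a + D <= t < a + l)), 2) <=
  \sum_(i < n) (l - D - i.+1) *
     \sum_(a < n) [&& a + i.+1 < n, Q a & Q (a + i.+1)].
Proof.
under eq_bigr => t _ do rewrite (bin2_sum_pairs n (fun a => Q a && (a + D <= t < a + l))).
rewrite exchange_big; apply: leq_sum => i _ /=.
rewrite exchange_big big_distrr; apply: leq_sum => a _ /=.
case: (boolP [&& a + i.+1 < n, Q a & Q (a + i.+1)]) => [/and3P[-> -> ->]|nQ] /=.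
  apply: (@leq_trans (\sum_(t < R) (a + i.+1 + D <= t < a + l))).
    by apply: leq_sum => t _; lia.
  by rewrite sum_range; lia.
rewrite big1 // => t _; apply/eqP; rewrite eqb0; apply: contra nQ.
by case/and3P=> -> /andP[-> _] /andP[-> _].
Qed.

(* [minn (lo + v) r.+1 - maxn lo (r.+1 - w)] is the number of points that the
   window of length [w] ending at [r] shares with [[lo, lo + v)]. *)
Lemma sum_windows (w lo v R : nat) (H : nat -> nat) :
  0 < w <= v -> lo + v + w <= R -> H 0 = 0 ->
  (v - w).+1 * H w + 2 * \sum_(x < w) H x <=
  \sum_(r < R) H (minn (lo + v) r.+1 - maxn lo (r.+1 - w)).
Proof.
move=> /andP[w_gt0 le_wv] le_R H0.
(* The length is now [w.+1]: [w] windows enter the interval, [w] leave it, and those in between lie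
   inside. [H 0 = 0] accounts for the term [x = 0]. *)
case: w w_gt0 le_wv le_R => // w _ le_wv le_R.
rewrite -(big_mkord xpredT (fun r => H (minn (lo + v) r.+1 - maxn lo (r.+1 - w.+1)))).
rewrite (@big_cat_nat _ _ _ lo) //=; last by lia.
rewrite (@big_cat_nat _ _ _ (lo + w) lo) //=; [|by lia|by lia].
rewrite (@big_cat_nat _ _ _ (lo + v) (lo + w)) //=; [|by lia|by lia].
rewrite (@big_cat_nat _ _ _ (lo + v + w) (lo + v)) //=; [|by lia|by lia].
have up : \sum_(lo <= r < lo + w) H (minn (lo + v) r.+1 - maxn lo (r.+1 - w.+1)) =
    \sum_(x < w.+1) H x.
  rewrite big_ord_recl H0 -{1}[lo]add0n big_addn addKn big_mkord.
  by apply: eq_bigr => i _; congr H; have := ltn_ord i; rewrite ?lift0 /=; lia.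
have middle : \sum_(lo + w <= r < lo + v)
    H (minn (lo + v) r.+1 - maxn lo (r.+1 - w.+1)) = (v - w.+1).+1 * H w.+1.
  rewrite (eq_big_nat _ _ (F2 := fun=> H w.+1)).
    by rewrite sum_nat_const_nat; congr (_ * _); lia.
  by move=> r r_in; congr H; lia.
have down : \sum_(lo + v <= r < lo + v + w)
    H (minn (lo + v) r.+1 - maxn lo (r.+1 - w.+1)) = \sum_(x < w.+1) H x.
  rewrite big_ord_recl H0 -{1}[lo + v]add0n big_addn addKn big_mkord.
  rewrite (reindex_inj rev_ord_inj).
  by apply: eq_bigr => i _; congr H; have := ltn_ord i; rewrite ?lift0 /=; lia.
rewrite up middle down; apply: leq_trans (leq_addl _ _).
by rewrite [leqRHS]addnCA leq_add2l mul2n -addnn leq_add2l leq_addr.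
Qed.

(** * Sidon sets from the absence of an L *)

Definition L_free (n : nat) (col : nat -> nat -> 'I_3) : Prop :=
  forall x y d, 0 < d -> x + d < n -> y + d < n ->
    col x y = col (x + d) y -> col (x + d) y = col (x + d) (y + d) -> False.

Definition corner_at (n : nat) (col : nat -> nat -> 'I_3) (g h : 'I_3) (D a : nat) : bool :=
  [&& a + D < n, col a a == g, col (a + D) (a + D) == g & col (a + D) a == h].

Lemma third_colour (g h x y : 'I_3) :
  g != h -> x != g -> x != h -> y != g -> y != h -> x = y.
Proof.
move=> gh xg xh yg yh; apply/eqP; rewrite -val_eqE /=.
move: gh xg xh yg yh; rewrite -!val_eqE /=.
by move: (ltn_ord g) (ltn_ord h) (ltn_ord x) (ltn_ord y); lia.
Qed.

(** The point [(y + D, x)] is the corner of two L's: one has ends [(x, x)] and [(y + D, y + D)] of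
    colour [g], the other [(x + D, x)] and [(y + D, y)] of colour [h]. *)
Lemma corner_colour n col g h D x y :
  L_free n col -> x < y -> corner_at n col g h D x -> corner_at n col g h D y ->
  col (y + D) x != g /\ col (y + D) x != h.
Proof.
move=> Lfree lt_xy /and4P[_ /eqP gx _ /eqP hx] /and4P[lt_n _ /eqP gy /eqP hy].
have [e e_gt0 def_y] : exists2 e, 0 < e & y = x + e by exists (y - x); lia.
rewrite {y}def_y in lt_xy lt_n gy hy *; split; apply/eqP => eq_col.
  have E : x + (e + D) = x + e + D by lia.
  by apply: (Lfree x x (e + D)); rewrite ?E ?gx ?gy ?eq_col //; lia.
have E : x + D + e = x + e + D by lia.
by apply: (Lfree (x + D) x e); rewrite ?E ?hx ?hy ?eq_col //; lia.
Qed.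

(* Two translates of the pair would give, in the third colour, the L with
   corner [(a' + d + D, a)] and ends [(a + d + D, a)] and [(a' + d + D, a')]. *)
Lemma corner_diff_unique n col g h D d a a' :
  L_free n col -> g != h -> 0 < d ->
  corner_at n col g h D a -> corner_at n col g h D (a + d) ->
  corner_at n col g h D a' -> corner_at n col g h D (a' + d) -> a = a'.
Proof.
move=> Lfree gh d_gt0.
wlog: a a' / a <= a' => [wlog_le|].
  by case: (leqP a a') => [|/ltnW] le_aa' *; [apply: wlog_le|apply/esym/wlog_le].
rewrite leq_eqVlt => /predU1P[//|lt_aa'] Sa Sad Sa' Sad'.
have [lt1 lt2 lt3] : [/\ a < a + d, a' < a' + d & a < a' + d] by split; lia.
have [R1g R1h] := corner_colour Lfree lt1 Sa Sad.
have [R2g R2h] := corner_colour Lfree lt2 Sa' Sad'.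
have [Cg Ch] := corner_colour Lfree lt3 Sa Sad'.
have /and4P[lt_n _ _ _] := Sad'.
have lt_a'n : a' < n by move: lt_n; clear; lia.
have E : a + d + D + (a' - a) = a' + d + D by move: lt_aa'; clear; lia.
have def_a' : a + (a' - a) = a' by rewrite subnKC // ltnW.
exfalso; apply: (Lfree (a + d + D) a (a' - a)); rewrite ?subn_gt0 ?E ?def_a' //.
  exact: third_colour gh _ _ _ _.
exact: third_colour gh _ _ _ _.
Qed.

Lemma sum_bool_leq1 n (Q : nat -> bool) :
  (forall a b, Q a -> Q b -> a = b) -> \sum_(a < n) Q a <= 1.
Proof.
move=> uniqQ; case: (pickP (fun a : 'I_n => Q a)) => [a Qa | Q0].
  rewrite (bigD1 a) //= Qa big1 // => b ne_ba; apply/eqP; rewrite eqb0.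
  by apply: contra ne_ba => Qb; apply/eqP/val_inj/uniqQ.
by rewrite big1 // => a _; rewrite Q0.
Qed.

(** Each difference occurs at most once, so only the weights [l - D - i.+1] of [sum_bin2_windows]
    remain to be summed. *)
Lemma corner_capacity n col g h D l R :
  L_free n col -> g != h ->
  \sum_(t < R) 'C(\sum_(a < n) (corner_at n col g h D a && (a + D <= t < a + l)), 2)
  <= 'C(l - D, 2).
Proof.
move=> Lfree gh; apply: leq_trans (sum_subn_leq n (l - D)).
apply: leq_trans (sum_bin2_windows _ _ _ _ _) _; apply: leq_sum => i _.
rewrite -[leqRHS]muln1; apply: leq_mul => //.
apply: (@sum_bool_leq1 n (fun a =>
  [&& a + i.+1 < n, corner_at n col g h D a & corner_at n col g h D (a + i.+1)])).
move=> a b /and3P[_ Sa Sa'] /and3P[_ Sb Sb'].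
by apply: (corner_diff_unique Lfree gh _ Sa Sa' Sb Sb').
Qed.

(** * Equally coloured pairs on the diagonal *)

Definition rep_at (n : nat) (col : nat -> nat -> 'I_3) (D a : nat) : bool :=
  (a + D < n) && (col a a == col (a + D) (a + D)).

(** The colours [g] of [(a, a)] and [h] of [(a + D, a)] are determined by [a], and they differ
    because [(a + D, a)] is the corner of an L. *)
Lemma rep_corners n col D a :
  L_free n col -> 0 < D ->
  \sum_g \sum_(h | h != g) corner_at n col g h D a = rep_at n col D a.
Proof.
move=> Lfree D_gt0; rewrite (bigD1 (col a a)) //= [X in _ + X]big1 ?addn0; last first.
  by move=> g ne_g; rewrite big1 // => h _; rewrite /corner_at eq_sym (negPf ne_g) andbF.
rewrite /rep_at /corner_at eqxx /= eq_sym.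
case: ltnP => lt_n; last by rewrite big1.
case: eqP => eq_g; last by rewrite big1.
rewrite (bigD1 (col (a + D) a)) /= ?eqxx; last first.
  by apply/eqP => eq_c; apply: (Lfree a a D); rewrite -?eq_g ?eq_c.
by rewrite big1 // => h /andP[_ ne_h]; rewrite eq_sym (negPf ne_h).
Qed.

(** A pair at distance [i.+1] fits into at most [w - i.+1] windows of length [w], whence the
    weights. *)
Lemma diagonal_windows n (col : nat -> nat -> 'I_3) l w R t :
  \sum_(r < R) \sum_g
     'C(\sum_(a < n) [&& col a a == g, a <= t < a + l & a <= r < a + w], 2) <=
  \sum_(i < n) (w - i.+1) *
     \sum_(a < n) (rep_at n col i.+1 a && (a + i.+1 <= t < a + l)).
Proof.
rewrite exchange_big /=.
have win_g g := sum_bin2_windows n w 0 R (fun a => (col a a == g) && (a <= t < a + l)).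
apply: (leq_trans (n := \sum_g \sum_(i < n) (w - i.+1) * \sum_(a < n)
  [&& a + i.+1 < n, (col a a == g) && (a <= t < a + l) &
     (col (a + i.+1) (a + i.+1) == g) && (a + i.+1 <= t < a + i.+1 + l)])).
  apply: leq_sum => g _; have := win_g g; rewrite subn0; apply: leq_trans.
  apply: leq_sum => r _; apply: leq_bin2l; apply: leq_sum => a _.
  by rewrite addn0 -!andbA.
rewrite exchange_big; apply: leq_sum => i _ /=.
rewrite -big_distrr leq_mul2l exchange_big; apply/orP; right.
apply: leq_sum => a _; rewrite (bigD1 (col a a)) //= big1 ?addn0; last first.
  by move=> g ne_g; rewrite eq_sym (negPf ne_g) /= andbF.
rewrite eqxx /= /rep_at [_ == col a a]eq_sym.
by case: (_ < n); case: (_ == _); lia.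
Qed.

(* Tangent bound for the number of equally coloured pairs among [v] points; the
   truncated subtraction is exact. *)
Definition mono_pairs (v : nat) : nat := v %/ 3 * v - 3 * 'C((v %/ 3).+1, 2).

Lemma mono_pairs_leq (m : 'I_3 -> nat) :
  mono_pairs (\sum_g m g) <= \sum_g 'C(m g, 2).
Proof.
rewrite leq_subLR addnC -[X in _ + X * _](card_ord 3).
exact: (@sum_bin2_tangent _ xpredT).
Qed.

Definition window_pairs (w v : nat) : nat :=
  (v - w).+1 * mono_pairs w + 2 * \sum_(x < w) mono_pairs x.

(* The tangent slope [v %/ 20] nearly maximizes this lower bound for [l = 198], [w = 66]. *)
Definition corner_pairs (w v : nat) : nat :=
  if v < w then 0
  else v %/ 20 * window_pairs w v - 6 * 'C((v %/ 20).+1, 2) * 'C(w, 2).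

Lemma window_pairs_leq n (col : nat -> nat -> 'I_3) l w t :
  let v := minn n t.+1 - (t.+1 - l) in 0 < w <= v ->
  window_pairs w v <=
  \sum_(i < n) (w - i.+1) *
     \sum_(a < n) (rep_at n col i.+1 a && (a + i.+1 <= t < a + l)).
Proof.
move=> v w_v; set lo := t.+1 - l.
apply: leq_trans (diagonal_windows n col l w (lo + v + w) t).
apply: leq_trans (sum_windows w_v (leqnn _) (erefl : mono_pairs 0 = 0)) _.
apply: leq_sum => r _; apply: leq_trans (mono_pairs_leq _).
(* The colour classes partition the points common to both windows. *)
rewrite exchange_big /=; apply: eq_leq; congr mono_pairs.
rewrite (eq_bigr (fun a : 'I_n => nat_of_bool
  (maxn lo (r.+1 - w) <= a < minn (lo + v) r.+1))) ?sum_range; first by lia.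
move=> a _; rewrite (bigD1 (col a a)) //= big1 ?addn0; last first.
  by move=> g ne_g; rewrite eq_sym (negPf ne_g).
by have := ltn_ord a; rewrite eqxx /=; lia.
Qed.

Definition corner_pairs_at n (col : nat -> nat -> 'I_3) l D t : nat :=
  \sum_g \sum_(h | h != g)
     'C(\sum_(a < n) (corner_at n col g h D a && (a + D <= t < a + l)), 2).

(** Convexity over the six sets S(g, h, D), cut down to one window; by [rep_corners] they partition
    the repetitions. *)
Lemma rep_tangent n col l D t q :
  L_free n col -> 0 < D ->
  q * \sum_(a < n) (rep_at n col D a && (a + D <= t < a + l)) <=
  corner_pairs_at n col l D t + 6 * 'C(q.+1, 2).
Proof.
move=> Lfree D_gt0.
have -> : \sum_(a < n) (rep_at n col D a && (a + D <= t < a + l)) =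
    \sum_g \sum_(h | h != g) \sum_(a < n) (corner_at n col g h D a && (a + D <= t < a + l)).
  under [RHS]eq_bigr => g _ do rewrite exchange_big.
  rewrite exchange_big /=; apply: eq_bigr => a _.
  rewrite -mulnb -rep_corners // big_distrl; apply: eq_bigr => g _ /=.
  by rewrite big_distrl; apply: eq_bigr => h _; rewrite /= mulnb.
rewrite big_distrr /= -[6]/(3 * 2) -mulnA -[X in _ + X * _](card_ord 3) -sum_nat_const -big_split.
apply: leq_sum => g _ /=; apply: leq_trans (sum_bin2_tangent _ _ _) _.
by rewrite leq_add2l leq_mul2r cardC1 card_ord leqnn orbT.
Qed.

Lemma corner_pairs_leq n col l w t :
  L_free n col -> 0 < w ->
  corner_pairs w (minn n t.+1 - (t.+1 - l)) <=
  \sum_(i < n) (w - i.+1) * corner_pairs_at n col l i.+1 t.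
Proof.
move=> Lfree w_gt0; set v := minn n t.+1 - _; rewrite /corner_pairs.
case: ltnP => // le_wv; set q := v %/ 20.
have w_v : 0 < w <= v by rewrite w_gt0.
rewrite leq_subLR; apply: (leq_trans (leq_mul (leqnn q) (window_pairs_leq col w_v))).
rewrite addnC; apply: (leq_trans (n := \sum_(i < n) (w - i.+1) *
  corner_pairs_at n col l i.+1 t + \sum_(i < n) (w - i.+1) * (6 * 'C(q.+1, 2)))).
  rewrite big_distrr -big_split; apply: leq_sum => i _ /=.
  by rewrite mulnCA -mulnDr; apply: leq_mul => //; exact: rep_tangent.
by rewrite leq_add2l -big_distrl /= mulnC leq_mul2l sum_subn_leq orbT.
Qed.

(** Sum [corner_pairs_leq] over all [t]: [sum_windows] with the whole diagonal as interval gives the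
    left side, [corner_capacity] for six colour pairs the right. *)
Lemma L_free_count n col l w :
  L_free n col -> 0 < w -> 0 < l <= n ->
  (n - l).+1 * corner_pairs w l + 2 * \sum_(x < l) corner_pairs w x <=
  \sum_(i < n) (w - i.+1) * (6 * 'C(l - i.+1, 2)).
Proof.
move=> Lfree w_gt0 l_n; have H0 : corner_pairs w 0 = 0 by rewrite /corner_pairs w_gt0.
apply: leq_trans (sum_windows (lo := 0) l_n (leqnn _) H0) _.
apply: (leq_trans (n := \sum_(t < 0 + n + l) \sum_(i < n) (w - i.+1) *
  corner_pairs_at n col l i.+1 t)).
  by apply: leq_sum => t _; rewrite max0n; apply: corner_pairs_leq.
rewrite exchange_big; apply: leq_sum => i _; rewrite -big_distrr leq_mul2l /=.
rewrite exchange_big; apply/orP; right; rewrite -[6]/(3 * 2) -mulnA.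
rewrite -[X in _ <= X * _](card_ord 3) -sum_nat_const; apply: leq_sum => g _.
rewrite exchange_big -[X in _ <= X * _](_ : #|[pred h : 'I_3 | h != g]| = 2); last first.
  by rewrite cardC1 card_ord.
by rewrite -sum_nat_const; apply: leq_sum => h ne_h; rewrite corner_capacity // eq_sym.
Qed.

(** * Numerical evaluation and conclusion *)

(* The final inequality involves numbers of order [10^8], so it is evaluated in
   binary. *)
Definition sumN (n : nat) (f : nat -> N) : N :=
  foldr (fun i s => N.add (f i) s) N0 (iota 0 n).

Lemma sumN_sum n f : N.to_nat (sumN n f) = \sum_(i < n) N.to_nat (f i).
Proof.
rewrite /sumN -(big_mkord xpredT (fun i => N.to_nat (f i))) /index_iota subn0.
by elim: (iota 0 n) => [|i s IHs]; rewrite ?big_nil // big_cons -IHs N2Nat.inj_add.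
Qed.

(** [S] stands for the sum of [mono_pairs] in [window_pairs], passed as an argument so that it is
    computed once. *)
Definition corner_pairsN (w : nat) (S : N) (v : nat) : N :=
  if v < w then N0 else
  let q := v %/ 20 in
  N.sub (N.mul (N.of_nat q)
           (N.add (N.of_nat ((v - w).+1 * mono_pairs w)) (N.mul 2 S)))
        (N.mul (N.of_nat (6 * 'C(q.+1, 2))) (N.of_nat 'C(w, 2))).

Definition lower_countN (n l w : nat) : N :=
  let S := sumN w (fun x => N.of_nat (mono_pairs x)) in
  N.add (N.mul (N.of_nat (n - l).+1) (corner_pairsN w S l))
        (N.mul 2 (sumN l (corner_pairsN w S))).

Definition upper_countN (n l w : nat) : N :=
  sumN n (fun i =>
    if w <= i then N0 else N.mul (N.of_nat ((w - i.+1) * 6)) (N.of_nat 'C(l - i.+1, 2))).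

Lemma count_ltN n l w :
  N.ltb (upper_countN n l w) (lower_countN n l w) ->
  \sum_(i < n) (w - i.+1) * (6 * 'C(l - i.+1, 2)) <
  (n - l).+1 * corner_pairs w l + 2 * \sum_(x < l) corner_pairs w x.
Proof.
have -> : \sum_(i < n) (w - i.+1) * (6 * 'C(l - i.+1, 2)) =
    N.to_nat (upper_countN n l w).
  rewrite sumN_sum; apply: eq_bigr => i _; case: leqP => [le_wi | _].
    by have /eqP-> : w - i.+1 == 0 by rewrite subn_eq0 leqW.
  by rewrite N2Nat.inj_mul !Nat2N.id mulnA.
have -> : (n - l).+1 * corner_pairs w l + 2 * \sum_(x < l) corner_pairs w x =
    N.to_nat (lower_countN n l w).
  rewrite /lower_countN; set S := sumN w _.
  have corner_pairsE v : N.to_nat (corner_pairsN w S v) = corner_pairs w v.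
    rewrite /corner_pairs /corner_pairsN; case: ifP => // _.
    rewrite N2Nat.inj_sub !N2Nat.inj_mul N2Nat.inj_add N2Nat.inj_mul !Nat2N.id sumN_sum.
    by under eq_bigr => x _ do rewrite Nat2N.id.
  rewrite N2Nat.inj_add 2!N2Nat.inj_mul Nat2N.id corner_pairsE sumN_sum.
  by under [in RHS]eq_bigr => x _ do rewrite corner_pairsE.
by move/N.ltb_lt => lt_N; apply/ltP/Nat.compare_lt_iff; rewrite -N2Nat.inj_compare.
Qed.

Lemma L_unavoidable_3_493 : L_unavoidable 3 493.
Proof.
move=> c; apply: NNPP => no_L.
(* [inord] sends indices outside the grid to 0, but [L_free 493] only constrains points inside
   it. *)
suff Lfree : L_free 493 (fun x y => c (inord x, inord y)).
  have lt_N : N.ltb (upper_countN 493 198 66) (lower_countN 493 198 66).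
    by vm_compute.
  have := @L_free_count 493 _ 198 66 Lfree isT isT.
  by have := count_ltN lt_N; rewrite ltnNge => /negP.
move=> x y d d_gt0 lt_x lt_y eq1 eq2; apply: no_L.
exists (inord x), (inord y), (inord (x + d)), (inord (y + d)), d.
by do 2!split=> //; rewrite !inordK //; lia.
Qed.

Theorem theorem6 : exists r : nat, is_RL 3 r /\ r <= 493.
Proof.
have [r [[[r_gt0 Lr] r_min] _]] :=
  dec_inh_nat_subset_has_unique_least_element
    (fun m => 0 < m /\ L_unavoidable 3 m) (fun m => classic _)
    (ex_intro _ 493 (conj isT L_unavoidable_3_493)).
exists r; split; last by apply/leP/r_min; split=> //; exact: L_unavoidable_3_493.
by split=> // m m_gt0 Lm; apply/leP/r_min.
Qed.
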